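(* Let $q$ be a prime power and let $n,d,\ell$ be positive integers with $\ell\ge n$. Let $(\widetilde{\mathbb{P}}[S])_{S\le\mathbb{F}_q^n}\in P(n,d,\ell)$. If $\widetilde{\mathbb{P}}[S]<0$ for some $S\le\mathbb{F}_q^n$, then there exists a large enough $\ell'\ge\ell$ such that $(\widetilde{\mathbb{P}}[S])_{S\le\mathbb{F}_q^n}\notin P(n,d,\ell')$.
   Context: For $w\in\mathbb{F}_q^n$, $|w|$ is the Hamming weight (number of nonzero coordinates), and $[d-1]=\{1,\dots,d-1\}$. $S\le T$ means that $S$ is a linear subspace of $T$. For a level $\ell$, $P(n,d,\ell)$ (the feasible region of level $\ell$ of the pseudoprobability formulation of the Krawtchouk LP hierarchy) is the set of real vectors $(\widetilde{\mathbb{P}}[S])_{S\le\mathbb{F}_q^n}$, indexed by the linear subspaces of $\mathbb{F}_q^n$, such that (1) $\sum_{S\le\mathbb{F}_q^n}\widetilde{\mathbb{P}}[S]=1$; (2) $\widetilde{\mathbb{P}}[S]=0$ whenever there is $w\in S$ with $|w|\in[d-1]$; (3) $\sum_{S\le U}|S|^\ell\,\widetilde{\mathbb{P}}[S]\ge0$ for all $U\le\mathbb{F}_q^n$; (4) $\sum_{U\le S\le\mathbb{F}_q^n}\widetilde{\mathbb{P}}[S]\ge0$ for all $U\le\mathbb{F}_q^n$. *)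

(* Defs.v *)
From HB Require Import structures.
From mathcomp Require Import all_boot all_order all_algebra all_field.
From mathcomp Require Import reals.

Set Implicit Arguments.
Unset Strict Implicit.
Unset Printing Implicit Defensive.

Import Order.TTheory GRing.Theory Num.Theory.

Local Open Scope ring_scope.

Section FiniteVspace.
(* Needed for the subtype structure of [{vspace vT}] over its matrix encoding. *)
Import VectorInternalTheory.
Variables (F : finFieldType) (vT : vectType F).

HB.instance Definition _ := [Countable of {vspace vT} by <:].
HB.instance Definition _ := [Finite of {vspace vT} by <:].

End FiniteVspace.

Definition hamming_weight (F : finFieldType) (n : nat) (w : 'rV[F]_n) : nat :=
  #|[set i | w 0 i != 0]|.

Definition pseudoprob_region (R : realType) (F : finFieldType) (n d l : nat)
    (P : {vspace 'rV[F]_n} -> R) : Prop :=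
  [/\ \sum_(S : {vspace 'rV[F]_n}) P S = 1,
      forall S : {vspace 'rV[F]_n},
        (exists2 w, w \in S & (1 <= hamming_weight w <= d.-1)%N) -> P S = 0,
      forall U : {vspace 'rV[F]_n},
        0 <= \sum_(S : {vspace 'rV[F]_n} | (S <= U)%VS) #|S|%:R ^+ l * P S
    & forall U : {vspace 'rV[F]_n},
        0 <= \sum_(S : {vspace 'rV[F]_n} | (U <= S)%VS) P S].

(* Main.v *)
(** For a subspace [S] with [P S < 0], apply condition (3) to [U := S]: a proper
    subspace of [S] has at most half as many elements as [S], so the term
    [|S| ^ l' * P S] outweighs all the others for large [l']. *)
Require Import Defs.
From mathcomp Require Import all_boot all_order all_algebra all_field.
From mathcomp Require Import reals.

Import Order.TTheory GRing.Theory Num.Theory.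

Local Open Scope ring_scope.

(** After scaling by [2 ^ k], each term with [i != i0] is at most [a i0 ^ k * |c i|], so the scaled
    sum is at most [a i0 ^ k * (2 ^ k * c i0 + M)], and the bracket is negative for large [k]. *)
Lemma sum_expr_lt0 (R : archiRealFieldType) (I : finType) (A : pred I)
    (a : I -> nat) (c : I -> R) (i0 : I) (l : nat) :
  A i0 -> (0 < a i0)%N -> c i0 < 0 ->
  (forall i, A i -> i != i0 -> ((a i).*2 <= a i0)%N) ->
  exists2 k, (l <= k)%N & \sum_(i | A i) (a i)%:R ^+ k * c i < 0.
Proof.
move=> Ai0 a_gt0 c_lt0 a_le.
pose M := \sum_(i | A i && (i != i0)) `|c i|.
(* The Archimedean bound exceeds [M / - c i0], and [k < 2 ^ k] then yields [ltM]. *)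
pose k := maxn l (Num.bound (M / - c i0)).
exists k; first exact: leq_maxl.
have M_ge0 : 0 <= M by apply: sumr_ge0.
have ltM : M < 2 ^+ k * - c i0.
  rewrite -ltr_pdivrMr ?oppr_gt0 //.
  apply: (lt_le_trans (archi_boundP _)); first by rewrite divr_ge0 // oppr_ge0 ltW.
  by rewrite -natrX ler_nat (leq_trans (leq_maxr l _)) // ltnW // ltn_expl.
have two_gt0 : 0 < 2 ^+ k :> R by rewrite exprn_gt0.
(* The positive factor [2 ^ k] keeps the sign and avoids dividing by [a i0]. *)
rewrite -(pmulr_rlt0 _ two_gt0) (bigD1 i0) //= mulrDr.
have rest : 2 ^+ k * \sum_(i | A i && (i != i0)) (a i)%:R ^+ k * c i
    <= (a i0)%:R ^+ k * M.
  rewrite !mulr_sumr; apply: ler_sum => i /andP[Ai ni].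
  (* The factor is absorbed as [(2 * a i) ^ k], where the doubling hypothesis applies. *)
  rewrite mulrA -exprMn -natrM mul2n.
  apply: (le_trans (ler_wpM2l _ (ler_norm _))); first exact: exprn_ge0.
  by rewrite ler_wpM2r // lerXn2r ?nnegrE ?ler0n // ler_nat a_le.
apply: (le_lt_trans (lerD (lexx _) rest)).
rewrite mulrCA -mulrDr pmulr_rlt0 ?exprn_gt0 ?ltr0n //.
by rewrite -subr_gt0 sub0r opprD -mulrN subr_gt0.
Qed.

(** A proper inclusion lowers the dimension, and each lost dimension costs a factor [#|F|], which is
    at least 2. *)
Lemma double_card_proper_vspace (F : finFieldType) (n : nat)
    (S T : {vspace 'rV[F]_n}) :
  (S <= T)%VS -> S != T -> (#|S|.*2 <= #|T|)%N.
Proof.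
move=> sST neST.
have ltd : (\dim S < \dim T)%N.
  rewrite ltn_neqAle dimvS // andbT; apply: contra neST => /eqP dimST.
  by rewrite eqEdim sST dimST leqnn.
rewrite !card_vspace -mul2n.
apply: (@leq_trans (#|F| ^ (\dim S).+1)); last by rewrite leq_exp2l ?finNzRing_gt1.
by rewrite expnS leq_mul2r finNzRing_gt1 orbT.
Qed.

Theorem proposition5p2 (R : realType) (F : finFieldType) (n d l : nat)
    (n_gt0 : (0 < n)%N) (d_gt0 : (0 < d)%N) (l_gt0 : (0 < l)%N)
    (le_nl : (n <= l)%N) (P : {vspace 'rV[F]_n} -> R)
    (P_region : pseudoprob_region d l P) :
  (exists S : {vspace 'rV[F]_n}, P S < 0) ->
  exists l' : nat, (l <= l')%N /\ ~ pseudoprob_region d l' P.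
Proof.
case=> S PS_lt0.
have card_gt0 : (0 < #|S|)%N by apply/card_gt0P; exists 0; rewrite mem0v.
have [k le_lk sum_lt0] := sum_expr_lt0 _ _ (fun T => (T <= S)%VS)
  (fun T : {vspace 'rV[F]_n} => #|T|) P S l (subvv S) card_gt0 PS_lt0
  (fun T => @double_card_proper_vspace F n T S).
exists k; split=> // -[_ _ /(_ S) + _].
by rewrite leNgt sum_lt0.
Qed.
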